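(* Let $\Psi:\mathbb{R}^n\to\mathbb{R}^{n_z}$ ($n_z\ge n$) be continuous with $\Psi(0)=0$, and let $A\in\mathbb{R}^{n_z\times n_z}$, $B\in\mathbb{R}^{n_z\times m}$, $C\in\mathbb{R}^{n\times n_z}$ be such that $C\Psi(x)=x$ for all $x\in\mathbb{R}^n$, the pair $(A,B)$ is stabilizable and the pair $(A,C)$ is observable. Suppose there are constants $r_\psi>0$ and $L_\psi>0$ with $\|\Psi(x)\|\le L_\psi\|x\|$ for all $x\in\mathcal{B}_{r_\psi}$. Let $Q\in\mathbb{R}^{n\times n}$, $R\in\mathbb{R}^{m\times m}$ be symmetric positive definite, let $P$ be the unique positive definite solution of $$P=C^{\mathsf T}QC+A^{\mathsf T}PA-A^{\mathsf T}PB(R+B^{\mathsf T}PB)^{-1}B^{\mathsf T}PA,$$ and let $K=-(R+B^{\mathsf T}PB)^{-1}B^{\mathsf T}PA$. Then there exists $\delta>0$ such that the following holds. Let $f:\mathbb{R}^n\times\mathbb{R}^m\to\mathbb{R}^n$ be continuously differentiable with $f(0,0)=0$, and suppose there are constants $r>0$ and $L>0$ such that the closed-loop one-step prediction error $$\bar e_{\mathrm{cl}}(x):=\Psi\big(f(x,K\Psi(x))\big)-A\Psi(x)-BK\Psi(x)$$ satisfies $\|\bar e_{\mathrm{cl}}(x)\|\le L\|x\|$ for all $x\in\mathcal{B}_r$. If $L<\delta$, then the closed-loop system $x_{t+1}=f(x_t,K\Psi(x_t))$ is locally exponentially stable (at the origin).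
   Context: $\mathcal{B}_r=\{x\in\mathbb{R}^n : \|x\|\le r\}$. The origin of $x_{t+1}=g(x_t)$ is locally exponentially stable if there exist $c>0$, $\rho\in(0,1)$ and a neighborhood $\mathcal{N}$ of the origin such that $\|x_t\|\le c\,\rho^t\|x_0\|$ for all $x_0\in\mathcal{N}$ and all $t\in\mathbb{Z}_{\ge 0}$. *)

(* Defs.v *)
From mathcomp Require Import all_boot all_order all_algebra.
From mathcomp Require Import complex.
From mathcomp Require Import all_classical all_reals all_analysis.

Set Implicit Arguments.
Unset Strict Implicit.
Unset Printing Implicit Defensive.

Import Order.TTheory GRing.Theory Num.Theory.
Import numFieldNormedType.Exports.

Local Open Scope classical_set_scope.
Local Open Scope ring_scope.

(* Euclidean norm: the library norm `|x| on matrices is the sup norm, which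
   induces the same topology. *)
Definition enorm (R : realType) (n : nat) (x : 'cV[R]_n) : R :=
  Num.sqrt (\sum_i x i 0 ^+ 2).

Definition eball (R : realType) (n : nat) (r : R) : set 'cV[R]_n :=
  [set x | enorm x <= r].

Definition posdef (R : realType) (n : nat) (M : 'M[R]_n) : Prop :=
  M^T = M /\ forall x : 'cV[R]_n, x != 0 -> 0 < (x^T *m M *m x) 0 0.

(* Spectral radius below 1, over all complex eigenvalues. *)
Definition schur_stable (R : realType) (n : nat) (M : 'M[R]_n) : Prop :=
  forall z : R[i], eigenvalue (map_mx (real_complex R) M) z -> `|z| < 1.

Definition stabilizable (R : realType) (n m : nat)
    (A : 'M[R]_n) (B : 'M[R]_(n, m)) : Prop :=
  exists F : 'M[R]_(m, n), schur_stable (A + B *m F).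

(* The output sequence C z_k of z_{k+1} = A z_k determines the initial state. *)
Definition observable (R : realType) (n p : nat)
    (A : 'M[R]_n) (C : 'M[R]_(p, n)) : Prop :=
  forall z z' : 'cV[R]_n,
    (forall k, C *m (A ^+ k *m z) = C *m (A ^+ k *m z')) -> z = z'.

(* Fréchet differentiable everywhere, with differential continuous for the
   operator norm. *)
Definition continuously_differentiable (R : realType) (V W : normedModType R)
    (f : V -> W) : Prop :=
  (forall p : V, differentiable f p) /\
  (forall (p : V) (e : R), 0 < e ->
     \forall q \near p, forall v : V, `|'d f q v - 'd f p v| <= e * `|v|).

Definition locally_exponentially_stable (R : realType) (n : nat)
    (g : 'cV[R]_n -> 'cV[R]_n) : Prop :=
  exists (c rho : R) (N : set 'cV[R]_n),
    [/\ 0 < c, 0 < rho < 1, nbhs (0 : 'cV[R]_n) N &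
      forall x0, N x0 -> forall t : nat,
        enorm (iter t g x0) <= c * rho ^+ t * enorm x0].

Definition closed_loop (R : realType) (n nz m : nat)
    (f : 'cV[R]_n * 'cV[R]_m -> 'cV[R]_n) (Psi : 'cV[R]_n -> 'cV[R]_nz)
    (K : 'M[R]_(m, nz)) (x : 'cV[R]_n) : 'cV[R]_n :=
  f (x, K *m Psi x).

Definition closed_loop_error (R : realType) (n nz m : nat)
    (f : 'cV[R]_n * 'cV[R]_m -> 'cV[R]_n) (Psi : 'cV[R]_n -> 'cV[R]_nz)
    (A : 'M[R]_nz) (B : 'M[R]_(nz, m)) (K : 'M[R]_(m, nz)) (x : 'cV[R]_n) :
    'cV[R]_nz :=
  Psi (f (x, K *m Psi x)) - A *m Psi x - B *m (K *m Psi x).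

(* Main.v *)
Require Import Defs.
From mathcomp Require Import all_boot all_order all_algebra.
From mathcomp Require Import complex.
From mathcomp Require Import all_classical all_reals all_analysis.
From mathcomp Require Import ring lra.

Import Order.TTheory GRing.Theory Num.Theory.
Import numFieldNormedType.Exports.

Local Open Scope classical_set_scope.
Local Open Scope ring_scope.

(** The optimal cost z^T P z of the linear-quadratic regulator, evaluated at
    z = Psi x, is a quadratic Lyapunov function for the nonlinear closed loop
    in the original coordinates x.

    In lifted coordinates the closed loop reads z+ = M z + e with M = A + B K
    and e the prediction error.  Substituting K into the Riccati equation gives
      M^T P M = P - C^T Q C - K^T R K          (dare_closed_loop),
    so, C z = x being the state, the nominal part of the step lowers the cost
    by at least x^T Q x >= q |x|^2.  The error adds terms of order |z| |e| and
    |e|^2 (bform_perturbed_le).  On the manifold z = Psi x one has both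
    |z| <= Lpsi |x| and |e| <= L |x| near the origin, so these terms are
    bounded by a multiple of L |x|^2 and cost at most half of the decrease once
    L is small.  Hence V x = (Psi x)^T P (Psi x) decreases by at least
    q / 2 |x|^2, hence by a fixed fraction of V x, although C^T Q C is only
    semidefinite on the whole lifted space.

    V is bounded above by a multiple of |x|^2 because |Psi x| <= Lpsi |x|, and
    below because x = C (Psi x) gives |x| <= const |Psi x|.  The quadratic
    Lyapunov theorem (lyapunov_quadratic) then yields exponential stability;
    it also shows that orbits never leave the ball on which the estimates
    hold. *)

(** * Bilinear forms of matrices *)

Definition bform {R : realType} {p q : nat} (M : 'M[R]_(p, q))
  (u : 'cV[R]_p) (v : 'cV[R]_q) : R := (u^T *m M *m v) 0 0.

Section BilinearForms.
Context {R : realType} {p q : nat}.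
Implicit Types (M : 'M[R]_(p, q)) (u : 'cV[R]_p) (v : 'cV[R]_q).

Lemma bformDl M u1 u2 v : bform M (u1 + u2) v = bform M u1 v + bform M u2 v.
Proof. by rewrite /bform linearD /= !mulmxDl mxE. Qed.

Lemma bformDr M u v1 v2 : bform M u (v1 + v2) = bform M u v1 + bform M u v2.
Proof. by rewrite /bform mulmxDr mxE. Qed.

Lemma bformZl M a u v : bform M (a *: u) v = a * bform M u v.
Proof. by rewrite /bform linearZ /= -!scalemxAl mxE. Qed.

Lemma bformZr M a u v : bform M u (a *: v) = a * bform M u v.
Proof. by rewrite /bform -scalemxAr mxE. Qed.

Lemma bformD M1 M2 u v : bform (M1 + M2) u v = bform M1 u v + bform M2 u v.
Proof. by rewrite /bform mulmxDr mulmxDl mxE. Qed.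

Lemma bformN M u v : bform (- M) u v = - bform M u v.
Proof. by rewrite /bform mulmxN mulNmx mxE. Qed.

Lemma bform_tr M u v : bform M^T v u = bform M u v.
Proof.
rewrite /bform -[in RHS](trmxK (u^T *m M *m v)) [RHS]mxE.
by rewrite !trmx_mul trmxK mulmxA.
Qed.

Lemma bform_congr {p' q' : nat} (M : 'M[R]_(p', q')) (X : 'M[R]_(p', p))
    (Y : 'M[R]_(q', q)) u v :
  bform (X^T *m M *m Y) u v = bform M (X *m u) (Y *m v).
Proof. by rewrite /bform trmx_mul !mulmxA. Qed.

End BilinearForms.

(** * The Euclidean norm *)

Section EuclideanNorm.
Context {R : realType}.

Lemma enorm_ge0 {n} (x : 'cV[R]_n) : 0 <= enorm x.
Proof. exact: sqrtr_ge0. Qed.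

Lemma sqr_enorm {n} (x : 'cV[R]_n) : enorm x ^+ 2 = \sum_i x i 0 ^+ 2.
Proof. by rewrite sqr_sqrtr // sumr_ge0 // => i _; exact: sqr_ge0. Qed.

Lemma sqr_enorm_mul {n p} (M : 'M[R]_(n, p)) (x : 'cV[R]_p) :
  enorm (M *m x) ^+ 2 = bform (M^T *m M) x x.
Proof.
rewrite sqr_enorm /bform mulmxA -trmx_mul -mulmxA mxE.
by apply: eq_bigr => i _; rewrite !mxE expr2.
Qed.

Lemma enorm_coord {n} (x : 'cV[R]_n) i : `|x i 0| <= enorm x.
Proof.
rewrite -(ler_pXn2r (n := 2)) ?nnegrE ?enorm_ge0 ?normr_ge0 //.
rewrite sqr_enorm real_normK ?num_real // (bigD1 i) //= lerDl.
by apply: sumr_ge0 => j _; exact: sqr_ge0.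
Qed.

Lemma bform_bounded {p q} (M : 'M[R]_(p, q)) :
  exists2 c : R, 0 < c &
    forall u v, `|bform M u v| <= c * (enorm u * enorm v).
Proof.
(* The summand 1 makes the constant positive even for the zero matrix. *)
exists (1 + \sum_j \sum_i `|M i j|).
  by rewrite ltr_pwDl //; do 2![apply: sumr_ge0 => ? _]; exact: normr_ge0.
move=> u v; rewrite mulrDl mul1r.
apply: ler_wpDl; first by rewrite mulr_ge0 ?enorm_ge0.
rewrite /bform mxE mulr_suml; apply: le_trans (ler_norm_sum _ _ _) _.
apply: ler_sum => j _; rewrite normrM mxE.
apply: (@le_trans _ _ (\sum_i `|M i j| * enorm u * enorm v)); last first.
  by rewrite mulr_suml; apply: ler_sum => i _; rewrite mulrA.
rewrite -mulr_suml ler_pM ?normr_ge0 ?enorm_coord //.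
apply: le_trans (ler_norm_sum _ _ _) _; apply: ler_sum => i _.
by rewrite mxE normrM mulrC ler_wpM2l ?normr_ge0 ?enorm_coord.
Qed.

Lemma bform_self_bounded {n} (M : 'M[R]_n) :
  exists2 c : R, 0 < c & forall x, bform M x x <= c * enorm x ^+ 2.
Proof.
have [c c0 cP] := bform_bounded M; exists c => // x.
by apply: le_trans (ler_norm _) _; rewrite expr2.
Qed.

(** The topology on column vectors is that of the sup norm, and a sup-norm ball
    of radius [e / (n + 1)] lies in the Euclidean ball of radius [e], since
    [n / (n + 1) ^ 2 <= 1]. *)
Lemma nbhs_eball {n} (e : R) : 0 < e -> nbhs (0 : 'cV[R]_n) (eball e).
Proof.
move=> e0; have n0 : 0 < n%:R + 1 :> R by rewrite ltr_wpDl.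
apply/nbhs_ballP; exists (e / (n%:R + 1)) => /=; first exact: divr_gt0.
move=> x [_ x0]; rewrite /eball /=.
rewrite -(ler_pXn2r (n := 2)) ?nnegrE ?enorm_ge0 ?(ltW e0) //.
rewrite sqr_enorm.
apply: (@le_trans _ _ (\sum_(i < n) (e / (n%:R + 1)) ^+ 2)).
  apply: ler_sum => i _; rewrite -real_normK ?num_real //.
  rewrite lerXn2r ?nnegrE ?normr_ge0 // ?divr_ge0 ?ltW //.
  by have := x0 i 0; rewrite /ball /= mxE sub0r normrN.
rewrite sumr_const card_ord -[leLHS]mulr_natl expr_div_n mulrCA ler_piMr ?sqr_ge0 //.
rewrite ler_pdivrMr ?exprn_gt0 // mul1r.
have := ler0n R n; nra.
Qed.

End EuclideanNorm.

(** * Positive definite matrices *)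

Section PositiveDefinite.
Context {R : realType} {n : nat}.
Implicit Types (M : 'M[R]_n).

Lemma posdef_gt0 M x : posdef M -> x != 0 -> 0 < bform M x x.
Proof. by move=> [_]; apply. Qed.

Lemma posdef_ge0 M x : posdef M -> 0 <= bform M x x.
Proof.
move=> Mpd; have [->|x0] := eqVneq x 0; last exact/ltW/posdef_gt0.
by rewrite /bform mulmx0 mxE.
Qed.

Lemma posdef_sym M u v : posdef M -> bform M v u = bform M u v.
Proof. by move=> [Msym _]; rewrite -[in LHS]Msym bform_tr. Qed.

Lemma posdef_unitmx M : posdef M -> M \in unitmx.
Proof.
move=> Mpd; rewrite -row_free_unit -kermx_eq0; apply/eqP/row_matrixP => i.
rewrite row0; apply/eqP; rewrite -trmx_eq0; apply/negPn/negP => /(posdef_gt0 _ _ Mpd).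
by rewrite /bform trmxK -row_mul mulmx_ker row0 mul0mx mxE ltxx.
Qed.

(** As for any inner product: evaluate the form at the component of [v]
    orthogonal to [u], scaled by [bform M u u] to avoid a division. *)
Lemma posdef_cauchy_schwarz M u v : posdef M ->
  bform M u v ^+ 2 <= bform M u u * bform M v v.
Proof.
move=> Mpd; have [->|u0] := eqVneq u 0.
  by rewrite /bform trmx0 !mul0mx !mxE expr0n mul0r.
have a0 := posdef_gt0 _ _ Mpd u0.
have := posdef_ge0 _ (bform M u u *: v + (- bform M u v) *: u) Mpd.
rewrite !(bformDl, bformDr, bformZl, bformZr) (posdef_sym _ u v) //.
set a := bform M u u in a0 *; set b := bform M u v; set c := bform M v v.
have -> : a * (a * c + - b * b) + (a * (- b * b) + - b * (- b * a))
  = a * (a * c - b ^+ 2) by ring.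
by rewrite pmulr_rge0 // subr_ge0.
Qed.

(** An algebraic argument replaces the minimum over the unit sphere: each
    coordinate [x i] is the [M]-inner product of [x] with [w i], the [i]-th
    column of the inverse of [M], so Cauchy-Schwarz bounds its square by
    [bform M x x] times the [M]-norm of [w i] squared. *)
Lemma posdef_coercive M : posdef M ->
  exists2 c : R, 0 < c & forall x, c * enorm x ^+ 2 <= bform M x x.
Proof.
move=> Mpd; pose w i : 'cV[R]_n := invmx M *m delta_mx i 0.
have coordE (x : 'cV[R]_n) i : x i 0 = bform M (w i) x.
  rewrite -posdef_sym // /bform /w -mulmxA mulKVmx ?posdef_unitmx //.
  by rewrite -colE !mxE.
have S0 : 0 <= \sum_i bform M (w i) (w i).
  by apply: sumr_ge0 => i _; exact: posdef_ge0.
have S1 : 0 < 1 + \sum_i bform M (w i) (w i) by rewrite ltr_pwDl.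
(* The summand 1 keeps the denominator positive when [n = 0]. *)
exists (1 + \sum_i bform M (w i) (w i))^-1; first by rewrite invr_gt0.
move=> x; rewrite mulrC ler_pdivrMr // mulrDr mulr1.
apply: ler_wpDl; first exact: posdef_ge0.
rewrite sqr_enorm mulr_sumr; apply: ler_sum => i _.
by rewrite coordE mulrC posdef_cauchy_schwarz.
Qed.

End PositiveDefinite.

Lemma posdefD_congr (R : realType) (n m : nat) (M : 'M[R]_m) (P : 'M[R]_n)
    (B : 'M[R]_(n, m)) :
  posdef M -> posdef P -> posdef (M + B^T *m P *m B).
Proof.
move=> Mpd Ppd; split.
  by rewrite linearD /= !trmx_mul trmxK mulmxA (proj1 Mpd) (proj1 Ppd).
move=> x x0; rewrite -/(bform _ x x) bformD bform_congr.
by rewrite ltr_pwDl ?posdef_gt0 ?posdef_ge0.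
Qed.

(** * The closed-loop form of the Riccati equation *)

(** With S = R + B^T P B, the gain satisfies S K = - B^T P A, so every product
    involving B in (A + B K)^T P (A + B K) can be expressed by K^T S K and
    K^T R K; the former is exactly the last term of the Riccati equation. *)
Lemma dare_closed_loop (R : realType) (n nz m : nat)
    (A : 'M[R]_nz) (B : 'M[R]_(nz, m)) (C : 'M[R]_(n, nz))
    (Qw : 'M[R]_n) (Rw : 'M[R]_m) (P : 'M[R]_nz) (K : 'M[R]_(m, nz)) :
  posdef Rw -> posdef P ->
  P = C^T *m Qw *m C + A^T *m P *m A
      - A^T *m P *m B *m invmx (Rw + B^T *m P *m B) *m B^T *m P *m A ->
  K = - (invmx (Rw + B^T *m P *m B) *m B^T *m P *m A) ->
  (A + B *m K)^T *m P *m (A + B *m K)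
    = P - C^T *m Qw *m C - K^T *m Rw *m K.
Proof.
move=> Rpd Ppd dare Kdef.
set S := Rw + _ in dare Kdef.
have Spd : posdef S by exact: posdefD_congr.
have Sunit := posdef_unitmx _ Spd.
have SK : B^T *m P *m A = - (S *m K).
  by rewrite Kdef mulmxN opprK -!mulmxA mulKVmx.
have KS : A^T *m P *m B = - (K^T *m S).
  have := congr1 trmx SK.
  by rewrite linearN /= !trmx_mul trmxK (proj1 Ppd) (proj1 Spd) mulmxA.
have dareK : P = C^T *m Qw *m C + A^T *m P *m A - K^T *m S *m K.
  rewrite {1}dare; congr (_ - _).
  have -> : A^T *m P *m B *m invmx S *m B^T *m P *m A
    = A^T *m P *m B *m (- K) by rewrite Kdef opprK !mulmxA.
  by rewrite KS mulNmx mulmxN opprK.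
have BPB : B^T *m P *m B = S - Rw by rewrite /S addrC addKr.
have -> : (A + B *m K)^T *m P *m (A + B *m K) =
    A^T *m P *m A + A^T *m P *m B *m K + K^T *m (B^T *m P *m A)
    + K^T *m (B^T *m P *m B) *m K.
  by rewrite [(A + _)^T]linearD /= trmx_mul !mulmxDl !mulmxDr !mulmxA !addrA.
rewrite KS SK BPB {2}dareK mulmxBr mulmxBl mulNmx mulmxN !mulmxA.
set a := A^T *m _ *m _; set b := K^T *m S *m K; set c := K^T *m _ *m _.
set d := C^T *m _ *m _.
by rewrite addrA subrK -[d + a - b]addrA [d + _]addrC addrK.
Qed.

(** * Lyapunov stability and perturbed decrease *)

(** The upper bound turns the additive decrease into a contraction of [V] by
    [s = b / (b + h)].  The factor [b / (b + h)], rather than the sharper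
    [1 - h / b], lies in ]0, 1[ whatever the constants.  Comparing [V] with the
    norm at both ends costs a factor [c = sqrt (b / a)], so an orbit starting
    within [r / c] stays in the ball of radius [r] and the contraction applies
    at every step. *)
Lemma lyapunov_quadratic (R : realType) (n : nat) (g : 'cV[R]_n -> 'cV[R]_n)
    (V : 'cV[R]_n -> R) (a b h r : R) :
  0 < a -> 0 < b -> 0 < h -> 0 < r ->
  (forall x, a * enorm x ^+ 2 <= V x) ->
  (forall x, eball r x -> V x <= b * enorm x ^+ 2) ->
  (forall x, eball r x -> V (g x) <= V x - h * enorm x ^+ 2) ->
  locally_exponentially_stable g.
Proof.
move=> a0 b0 h0 r0 Vge Vle Vdec.
have bh0 : 0 < b + h by rewrite addr_gt0.
pose s := b / (b + h).
have s0 : 0 < s by exact: divr_gt0.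
have s1 : s < 1 by rewrite ltr_pdivrMr // mul1r ltrDl.
have Vcontr x : eball r x -> V (g x) <= s * V x.
  move=> xr; apply: le_trans (Vdec x xr) _.
  have := Vle x xr; have := sqr_ge0 (enorm x).
  set e := enorm x ^+ 2; set v := V x => e0 ve.
  rewrite /s mulrAC ler_pdivlMr //; nra.
pose c := Num.sqrt (b / a).
have c0 : 0 < c by rewrite sqrtr_gt0 divr_gt0.
have csq : c ^+ 2 = b / a by rewrite sqr_sqrtr // ltW // divr_gt0.
exists c, (Num.sqrt s), (eball (Num.min r (r / c))); split => //.
- by rewrite sqrtr_gt0 s0 -sqrtr1 ltr_sqrt.
- by apply: nbhs_eball; rewrite lt_min r0 divr_gt0.
move=> x0; rewrite /eball /= le_min ler_pdivlMr // mulrC => /andP[x0r cx0r].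
have bound t : V (iter t g x0) <= s ^+ t * V x0 ->
    enorm (iter t g x0) <= c * Num.sqrt s ^+ t * enorm x0.
  move=> Vt; rewrite -(ler_pXn2r (n := 2)) ?nnegrE ?enorm_ge0 //; last first.
    by rewrite !mulr_ge0 ?exprn_ge0 ?sqrtr_ge0 ?enorm_ge0.
  rewrite !exprMn csq exprAC (sqr_sqrtr (ltW s0)) -(ler_pM2l a0); apply: le_trans (Vge _) _.
  apply: le_trans Vt _.
  have -> : a * (b / a * s ^+ t * enorm x0 ^+ 2) = s ^+ t * (b * enorm x0 ^+ 2).
    by field; rewrite gt_eqF.
  by rewrite ler_wpM2l ?exprn_ge0 ?(ltW s0) // Vle.
move=> t; apply: (bound); elim: t => [|t IH]; first by rewrite expr0 mul1r.
rewrite iterS exprS -mulrA; apply: le_trans (Vcontr _ _) _; last first.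
  by rewrite ler_wpM2l ?(ltW s0).
apply: le_trans (bound t IH) _; apply: le_trans cx0r.
rewrite -mulrA ler_wpM2l ?(ltW c0) // ler_piMl ?enorm_ge0 //.
by rewrite exprn_ile1 ?sqrtr_ge0 // -sqrtr1 ler_sqrt // ltW.
Qed.

(** Expanding the square, the symmetry of [P] makes the two cross terms equal,
    which is where [c] comes from. *)
Lemma bform_perturbed_le (R : realType) (k : nat) (P M : 'M[R]_k) : posdef P ->
  exists c d : R, [/\ 0 < c, 0 < d & forall z e,
    bform P (M *m z + e) (M *m z + e) <=
      bform (M^T *m P *m M) z z + c * (enorm z * enorm e) + d * enorm e ^+ 2].
Proof.
move=> Ppd; have [c c0 cP] := bform_bounded (M^T *m P).
have [d d0 dP] := bform_self_bounded P.
exists (2 * c), d; split => // [|z e]; first by rewrite mulr_gt0.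
rewrite bformDl !bformDr (posdef_sym _ (M *m z) e) // bform_congr.
have -> : bform P (M *m z) e = bform (M^T *m P) z e.
  by rewrite /bform trmx_mul !mulmxA.
have := dP e; have := le_trans (ler_norm _) (cP z e); lra.
Qed.

Theorem theorem2 (R : realType) (n nz m : nat) (le_n_nz : (n <= nz)%N)
    (Psi : 'cV[R]_n -> 'cV[R]_nz)
    (Psi_cont : continuous Psi) (Psi0 : Psi 0 = 0)
    (A : 'M[R]_nz) (B : 'M[R]_(nz, m)) (C : 'M[R]_(n, nz))
    (CPsi : forall x, C *m Psi x = x)
    (AB_stab : stabilizable A B) (AC_obs : observable A C)
    (rpsi Lpsi : R) (rpsi_gt0 : 0 < rpsi) (Lpsi_gt0 : 0 < Lpsi)
    (Psi_lin : forall x, eball rpsi x -> enorm (Psi x) <= Lpsi * enorm x)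
    (Qw : 'M[R]_n) (Rw : 'M[R]_m) (Qw_pd : posdef Qw) (Rw_pd : posdef Rw)
    (P : 'M[R]_nz) (P_pd : posdef P)
    (P_dare : P = C^T *m Qw *m C + A^T *m P *m A
                  - A^T *m P *m B *m invmx (Rw + B^T *m P *m B)
                    *m B^T *m P *m A)
    (K : 'M[R]_(m, nz))
    (K_def : K = - (invmx (Rw + B^T *m P *m B) *m B^T *m P *m A)) :
  exists2 delta : R, 0 < delta &
    forall f : 'cV[R]_n * 'cV[R]_m -> 'cV[R]_n,
      continuously_differentiable f -> f (0, 0) = 0 ->
      forall r L : R, 0 < r -> 0 < L ->
        (forall x, eball r x ->
           enorm (closed_loop_error f Psi A B K x) <= L * enorm x) ->
        L < delta ->
        locally_exponentially_stable (closed_loop f Psi K).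
Proof.
have riccati := dare_closed_loop _ _ _ _ _ _ _ _ _ _ _ Rw_pd P_pd P_dare K_def.
have [q q0 qP] := posdef_coercive _ Qw_pd.
have [p p0 pP] := posdef_coercive _ P_pd.
have [p' p'0 p'P] := bform_self_bounded P.
have [k k0 kP] := bform_self_bounded (C^T *m C).
have [c [d [c0 d0 cross]]] := bform_perturbed_le _ _ P (A + B *m K) P_pd.
have D0 : 0 < c * Lpsi + d by rewrite addr_gt0 // mulr_gt0.
(* With L <= 1 one has L ^ 2 <= L, so the error terms are at most
   (c * Lpsi + d) * L * |x| ^ 2, which the second bound makes at most
   q / 2 * |x| ^ 2. *)
exists (Num.min 1 (q / (2 * (c * Lpsi + d)))).
  by rewrite lt_min ltr01 divr_gt0 // mulr_gt0.
move=> f _ _ r L r0 L0 errP; rewrite lt_min ltr_pdivlMr ?mulr_gt0 //.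
move=> /andP[L1 LD].
pose V x := bform P (Psi x) (Psi x).
apply: (@lyapunov_quadratic _ _ _ V (p / k) (p' * Lpsi ^+ 2) (q / 2)
          (Num.min r rpsi)).
- exact: divr_gt0.
- by rewrite mulr_gt0 // exprn_gt0.
- exact: divr_gt0.
- by rewrite lt_min r0.
- move=> x; apply: le_trans (pP _).
  by rewrite -mulrA ler_pM2l // mulrC ler_pdivrMr // mulrC -{1}(CPsi x) sqr_enorm_mul.
- move=> x; rewrite /eball /= le_min => /andP[_ xr].
  apply: le_trans (p'P _) _; rewrite -mulrA ler_pM2l // -exprMn.
  by rewrite lerXn2r ?nnegrE ?enorm_ge0 ?mulr_ge0 ?enorm_ge0 ?(ltW Lpsi_gt0) ?Psi_lin.
move=> x; rewrite /eball /= le_min => /andP[xr xrpsi].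
have nextE : Psi (closed_loop f Psi K x) =
    (A + B *m K) *m Psi x + closed_loop_error f Psi A B K x.
  rewrite /closed_loop_error /closed_loop mulmxDl -mulmxA.
  by rewrite -[X in _ + X]addrA -opprD subrKC.
rewrite /V nextE; set e := closed_loop_error _ _ _ _ _ _.
apply: le_trans (cross _ _) _.
rewrite riccati !bformD !bformN !bform_congr CPsi.
have := qP x; have := posdef_ge0 _ (K *m Psi x) Rw_pd.
have eL : enorm e <= L * enorm x by exact: errP.
have zL := Psi_lin x xrpsi.
have x0 := enorm_ge0 x; have e0 := enorm_ge0 e.
have z0 := enorm_ge0 (Psi x).
have ze : enorm (Psi x) * enorm e <= Lpsi * L * enorm x ^+ 2.
  apply: le_trans (ler_pM z0 e0 zL eL) _.
  by rewrite le_eqVlt; apply/orP; left; apply/eqP; ring.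
have ee : enorm e ^+ 2 <= L * enorm x ^+ 2.
  apply: (@le_trans _ _ ((L * enorm x) ^+ 2)).
    by rewrite lerXn2r ?nnegrE ?mulr_ge0 ?(ltW L0).
  by rewrite exprMn ler_wpM2r ?sqr_ge0 // expr2 ler_piMl ?ltW.
have czze : c * (enorm (Psi x) * enorm e) <= c * (Lpsi * L * enorm x ^+ 2).
  by rewrite ler_pM2l.
have dee : d * enorm e ^+ 2 <= d * (L * enorm x ^+ 2) by rewrite ler_pM2l.
have := ler_wpM2r (sqr_ge0 (enorm x)) (ltW LD).
lra.
Qed.
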